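(* Let $\mathcal{X} \subseteq \mathbb{R}^n$ be a nonempty closed convex set, let $f(\mathbf{x}) = \frac{1}{2}\mathbf{x}^{\top} A \mathbf{x} + \mathbf{b}^{\top}\mathbf{x} + c$ with $A \in \mathbb{R}^{n\times n}$ symmetric positive semidefinite, $\mathbf{b} \in \mathbb{R}^n$, $c \in \mathbb{R}$, and let $\alpha > 0$. Let $(\boldsymbol{\gamma}^{(k)})_{k}$ be a sequence of vectors in $\mathbb{R}^n$ with strictly positive entries, and define, for each $k$ and each $\mathbf{x} \in \mathbb{R}^n$, $$\Gamma^{(k)}(\mathbf{x}) := \begin{cases} \mathrm{diag}(\boldsymbol{\gamma}^{(k)}) & \text{if } \mathbf{x} - \alpha\, \mathrm{diag}(\boldsymbol{\gamma}^{(k)}) \nabla f(\mathbf{x}) \in \mathcal{X}, \\ I & \text{otherwise.} \end{cases}$$ Then for each $k$, the set of points $\mathbf{x}$ satisfying $$\mathbf{x} = \mathrm{Proj}_{\mathcal{X}}\{\mathbf{x} - \alpha\, \Gamma^{(k)}(\mathbf{x}) \nabla f(\mathbf{x})\}$$ coincides with the set of points $\mathbf{x}$ satisfying $$\mathbf{x} = \mathrm{Proj}_{\mathcal{X}}\{\mathbf{x} - \alpha \nabla f(\mathbf{x})\}.$$ Therefore, the set of points satisfying the first equation coincides with the set of optimal solutions to $\min_{\mathbf{x} \in \mathcal{X}} f(\mathbf{x})$.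
   Context: $\mathrm{Proj}_{\mathcal{X}}(\mathbf{z}) := \arg\min_{\mathbf{x} \in \mathcal{X}} \|\mathbf{z} - \mathbf{x}\|_2$ is the Euclidean projection onto $\mathcal{X}$. $\mathrm{diag}(\boldsymbol{\gamma})$ is the diagonal matrix with diagonal $\boldsymbol{\gamma}$, and $I$ is the identity matrix. *)

(* Defs.v *)
From HB Require Import structures.
From mathcomp Require Import all_boot all_order all_algebra.
From mathcomp Require Import all_classical all_reals all_analysis.
Set Implicit Arguments.
Unset Strict Implicit.
Unset Printing Implicit Defensive.
Import Order.TTheory GRing.Theory Num.Theory.
Import numFieldNormedType.Exports.
Local Open Scope classical_set_scope.
Local Open Scope ring_scope.

(* The library norm `|x| on matrices is the sup norm (it induces the usual
   topology of R^n, so [closed] is unaffected); projections need the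
   Euclidean one. *)
Definition norm2 (R : realType) (n : nat) (x : 'cV[R]_n) : R :=
  Num.sqrt (\sum_(i < n) x i 0 ^+ 2).

Definition argmin (R : realType) (T : Type) (X : set T) (g : T -> R) : set T :=
  [set x | X x /\ forall y, X y -> g x <= g y].

(* A point of the argmin, and 0 if there is none; when X is nonempty, closed
   and convex, the argmin is a singleton. *)
Definition Proj (R : realType) (n : nat) (X : set 'cV[R]_n) (z : 'cV[R]_n) :
    'cV[R]_n :=
  xget 0 (argmin X (fun x => norm2 (z - x))).

Definition grad (R : realType) (n : nat) (f : 'cV[R]_n -> R) (x : 'cV[R]_n) :
    'cV[R]_n :=
  \col_(i < n) 'D_(delta_mx i 0) f x.

Definition diagc (R : realType) (n : nat) (g : 'cV[R]_n) : 'M[R]_n :=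
  diag_mx g^T.

Definition possemidef (R : realType) (n : nat) (A : 'M[R]_n) : Prop :=
  forall v : 'cV[R]_n, 0 <= (v^T *m A *m v) 0 0.

(* \Gamma^(k)(x), for g = \gamma^(k) *)
Definition scaling (R : realType) (n : nat) (X : set 'cV[R]_n)
    (f : 'cV[R]_n -> R) (alpha : R) (g x : 'cV[R]_n) : 'M[R]_n :=
  if `[< X (x - alpha *: (diagc g *m grad f x)) >] then diagc g else 1%:M.

(* Main.v *)
(* Both the optimality of x for f on X and the fixed-point equation of the
   unscaled step are equivalent to the variational inequality
   <grad f x, y - x> >= 0 for all y in X. The two steps differ only when
   z = x - alpha D grad f x lies in X, with D = diag gamma; there, evaluating
   the variational inequality of either step at y = z gives
   |D grad f x|^2 <= 0, respectively <grad f x, D grad f x> <= 0, so that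
   grad f x = 0 and both equations reduce to x in X. *)
Require Import Defs.
From HB Require Import structures.
From mathcomp Require Import all_boot all_order all_algebra.
From mathcomp Require Import all_classical all_reals all_analysis.
From mathcomp Require Import ring lra.
Import Order.TTheory GRing.Theory Num.Theory.
Import numFieldNormedType.Exports.
Local Open Scope classical_set_scope.
Local Open Scope ring_scope.

Definition dot {R : realType} {n : nat} (u v : 'cV[R]_n) : R := (u^T *m v) 0 0.

(** * Inner product and diagonal scalings *)

Section DotProduct.
Context {R : realType} {n : nat}.
Implicit Types u v w : 'cV[R]_n.

Lemma dotE u v : dot u v = \sum_i u i 0 * v i 0.
Proof. by rewrite /dot mxE; apply: eq_bigr => i _; rewrite mxE. Qed.

Lemma dotC u v : dot u v = dot v u.
Proof. by rewrite !dotE; apply: eq_bigr => i _; rewrite mulrC. Qed.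

Lemma dotDr u v w : dot u (v + w) = dot u v + dot u w.
Proof. by rewrite /dot mulmxDr mxE. Qed.

Lemma dotZr a u v : dot u (a *: v) = a * dot u v.
Proof. by rewrite /dot -scalemxAr mxE. Qed.

Lemma dotNr u v : dot u (- v) = - dot u v.
Proof. by rewrite -scaleN1r dotZr mulN1r. Qed.

Lemma dotDl u v w : dot (u + v) w = dot u w + dot v w.
Proof. by rewrite !(dotC _ w) dotDr. Qed.

Lemma dotZl a u v : dot (a *: u) v = a * dot u v.
Proof. by rewrite !(dotC _ v) dotZr. Qed.

Lemma dotNl u v : dot (- u) v = - dot u v.
Proof. by rewrite !(dotC _ v) dotNr. Qed.

Lemma dot0l u : dot 0 u = 0.
Proof. by rewrite /dot trmx0 mul0mx mxE. Qed.

Lemma dot_delta (i : 'I_n) u : dot (delta_mx i 0) u = u i 0.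
Proof.
rewrite dotE (bigD1 i)//= big1 => [|j /negPf ji]; rewrite mxE ?eqxx ?ji.
  by rewrite mul1r addr0.
by rewrite mul0r.
Qed.

Lemma dotvv_ge0 u : 0 <= dot u u.
Proof. by rewrite dotE sumr_ge0// => i _; rewrite -expr2 sqr_ge0. Qed.

Lemma sqr_coord_le_dotvv u i : u i 0 ^+ 2 <= dot u u.
Proof.
by rewrite dotE (bigD1 i)//= expr2 lerDl sumr_ge0// => j _; rewrite -expr2 sqr_ge0.
Qed.

Lemma dotvv_le0 u : dot u u <= 0 -> u = 0.
Proof.
move=> u0; apply/matrixP => i j; rewrite ord1 mxE; apply/eqP.
by rewrite -sqrf_eq0 eq_le sqr_ge0 andbT (le_trans (sqr_coord_le_dotvv u i)).
Qed.

Lemma norm2E u : norm2 u = Num.sqrt (dot u u).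
Proof. by rewrite /norm2 dotE; congr Num.sqrt; apply: eq_bigr => i _; rewrite expr2. Qed.

Lemma diagcE (g v : 'cV[R]_n) i : (diagc g *m v) i 0 = g i 0 * v i 0.
Proof. by rewrite /diagc mul_diag_mx !mxE. Qed.

(** The inner product is the sum of the nonnegative terms [g i 0 * v i 0 ^+ 2], so each of them
    vanishes. *)
Lemma dot_diagc_eq0 (g v : 'cV[R]_n) :
  (forall i, 0 < g i 0) -> dot v (diagc g *m v) <= 0 -> v = 0.
Proof.
move=> g0; rewrite dotE => le0.
have ge0 i : 0 <= v i 0 * (diagc g *m v) i 0.
  by rewrite diagcE mulrCA -expr2 mulr_ge0 ?sqr_ge0 ?ltW.
have /eqP : \sum_i v i 0 * (diagc g *m v) i 0 = 0.
  by apply/eqP; rewrite eq_le le0 sumr_ge0.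
rewrite psumr_eq0// => /allP all0; apply/matrixP => i j; rewrite ord1 mxE.
move/(_ i (mem_index_enum i)) : all0; rewrite diagcE !mulf_eq0 (gt_eqF (g0 i)).
by rewrite orbb => /eqP.
Qed.

Lemma diagc_mul_eq0 (g v : 'cV[R]_n) :
  (forall i, 0 < g i 0) -> diagc g *m v = 0 -> v = 0.
Proof. by move=> g0 gv; apply: (dot_diagc_eq0 _ _ g0); rewrite gv dotC dot0l. Qed.

End DotProduct.

(** * Minimisers over a convex set as variational inequalities *)

Section VariationalInequality.
Context {R : realType} {n : nat} {X : set 'cV[R]_n}.
Hypothesis X_convex : convex_set (X : set (convex_lmodType 'cV[R]_n)).

Lemma convex_segment {x y : 'cV[R]_n} {t : R} :
  X x -> X y -> 0 <= t -> t <= 1 -> X (x + t *: (y - x)).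
Proof.
move=> Xx Xy t0 t1.
have t01 : Itv.spec (Itv.num_sem (R := R)) (Itv.Real `[0%Z, 1%Z]) t.
  by rewrite /= /Itv.num_sem/= num_real/= in_itv/= t0 t1.
(* The weight [t] falls on the first point, hence [y] comes before [x]. *)
have /set_mem := X_convex _ _ (Itv.mk t01) (mem_set Xy) (mem_set Xx).
congr X; rewrite /conv/=.
by rewrite /unstable.onem scalerBl scale1r scalerBr addrCA addrA.
Qed.

(* If [l < 0], a step of length [t = -l / (q - l)] decreases [phi]: the change
   [t l + t^2 q] equals [- t l^2 / (q - l)]. *)
Lemma argmin_quadraticP (phi L Q : 'cV[R]_n -> R) (x : 'cV[R]_n) :
  (forall t d, phi (x + t *: d) = phi x + t * L d + t ^+ 2 * Q d) ->
  (forall d, 0 <= Q d) ->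
  argmin X phi x <-> X x /\ forall y, X y -> 0 <= L (y - x).
Proof.
move=> phiE Q0; split=> -[Xx xmin]; split=> // y Xy; last first.
  (* Sufficiency: the unit step from [x] along [y - x] lands on [y]. *)
  have := phiE 1 (y - x); rewrite scale1r subrKC => ->.
  by rewrite mul1r expr1n mul1r -addrA lerDl addr_ge0 ?xmin.
set d := y - x; rewrite leNgt; apply/negP => Ld.
have QL : 0 < Q d - L d by have := Q0 d; lra.
pose t := - L d / (Q d - L d).
have t0 : 0 < t by rewrite divr_gt0// oppr_gt0.
have t1 : t <= 1 by rewrite ler_pdivrMr// mul1r; have := Q0 d; lra.
have := xmin _ (convex_segment Xx Xy (ltW t0) t1); rewrite phiE.
have -> : phi x + t * L d + t ^+ 2 * Q d = phi x - t * (L d ^+ 2 / (Q d - L d)).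
  by rewrite /t; field; rewrite gt_eqF.
rewrite lerDl oppr_ge0 leNgt mulr_gt0// divr_gt0//.
by rewrite exprn_even_gt0//= lt_eqF.
Qed.

(** The square root is monotone; removing it leaves a quadratic objective. *)
Lemma argmin_norm2 (z : 'cV[R]_n) :
  argmin X (fun x => norm2 (z - x)) = argmin X (fun x => dot (z - x) (z - x)).
Proof.
rewrite /argmin; apply/seteqP; split=> x [Xx xmin]; split=> // y /xmin;
  by rewrite !norm2E ler_sqrt ?dotvv_ge0.
Qed.

(** This is the form required by [argmin_quadraticP], with [L d = 2 * dot (x - z) d] and
    [Q d = dot d d]. *)
Lemma sqdist_expand (z x : 'cV[R]_n) t (d : 'cV[R]_n) :
  dot (z - (x + t *: d)) (z - (x + t *: d)) =
  dot (z - x) (z - x) + t * (2 * dot (x - z) d) + t ^+ 2 * dot d d.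
Proof.
rewrite !(dotDl, dotDr, dotNl, dotNr, dotZl, dotZr).
rewrite (dotC x z) (dotC d z) (dotC d x); ring.
Qed.

Lemma argmin_norm2P (z x : 'cV[R]_n) :
  argmin X (fun x => norm2 (z - x)) x <->
  X x /\ forall y, X y -> 0 <= dot (x - z) (y - x).
Proof.
rewrite argmin_norm2 (argmin_quadraticP _ _ _ _ (sqdist_expand z x)); last first.
  exact: dotvv_ge0.
by split=> -[Xx h]; split=> // y /h; rewrite pmulr_rge0.
Qed.

(** Testing each variational inequality at the other minimiser and adding gives
    [dot (x - y) (x - y) <= 0]. *)
Lemma argmin_norm2_uniq (z x y : 'cV[R]_n) :
  argmin X (fun x => norm2 (z - x)) x ->
  argmin X (fun x => norm2 (z - x)) y -> x = y.
Proof.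
move=> /argmin_norm2P[Xx hx] /argmin_norm2P[Xy hy].
apply/eqP; rewrite -subr_eq0; apply/eqP/dotvv_le0.
have := hx _ Xy; have := hy _ Xx.
rewrite !(dotDl, dotDr, dotNl, dotNr); lra.
Qed.

(** * Existence of the projection and fixed points of projected steps *)

Hypotheses (X_neq0 : X !=set0) (X_closed : closed X).

(** The squared distance attains its minimum on the compact set of points of [X] no farther from [z]
    than some [x0] in [X]. *)
Lemma argmin_norm2_exists (z : 'cV[R]_n) :
  exists x, argmin X (fun x => norm2 (z - x)) x.
Proof.
have [x0 Xx0] := X_neq0.
(* Row vectors are used to match [rV_compact]; the minimiser is transposed back at the end. *)
pose g (u : 'rV[R]_n) : R := dot (z - u^T) (z - u^T).
have gE u : g u = \sum_i (z i 0 - u 0 i) * (z i 0 - u 0 i).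
  by rewrite /g dotE; apply: eq_bigr => i _; rewrite !mxE.
have g_cont : continuous g.
  rewrite (_ : g = fun u => \sum_i (z i 0 - u 0 i) * (z i 0 - u 0 i)); last exact/funext.
  apply: continuous_big => [|i _ u]; first exact: add_continuous.
  have zu_cvg : z i 0 - v 0 i @[v --> u] --> z i 0 - u 0 i.
    by apply: cvgB; [exact: cvg_cst|exact: coord_continuous].
  exact: (cvgM zu_cvg zu_cvg).
have tr_cont : continuous (trmx : 'rV[R]_n -> 'cV[R]_n).
  move=> u B /= /(nbhs_ballP u^T)[e e0 eB]; apply/nbhs_ballP; exists e => //= v [_ uv].
  by apply: eB; split=> // i j; rewrite !mxE; exact: uv.
pose r := g x0^T.
pose K := [set u : 'rV[R]_n | X u^T] `&` [set u | g u <= r].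
have K_compact : compact K.
  apply: (@subclosed_compact _ _
      [set u : 'rV[R]_n | forall i, `[z i 0 - Num.sqrt r, z i 0 + Num.sqrt r]%classic (u ord0 i)]).
  - apply: closedI; first exact: (closed_comp (fun u _ => tr_cont u)).
    exact: (closed_comp (fun u _ => g_cont u) (@closed_le _ r)).
  - exact: (@rV_compact _ _
      (fun i => `[z i 0 - Num.sqrt r, z i 0 + Num.sqrt r]%classic)
      (fun i => @segment_compact _ _ _)).
  (* One squared coordinate of [z - u^T] is at most the whole sum, hence at most [r]: the sublevel
     set lies in the box. *)
  - move=> u [_ /= gu] i /=; rewrite in_itv/= -ler_distlC -sqrtr_sqr ler_wsqrtr//.
    apply: le_trans gu; have := sqr_coord_le_dotvv (z - u^T) i.
    by rewrite !mxE.
have K0 : K !=set0 by exists x0^T; split; rewrite /= ?trmxK.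
have [u /set_mem[Xu gu] umin] := compact_EVT_min K0 K_compact (continuous_subspaceT g_cont).
exists u^T; rewrite argmin_norm2; split=> // y Xy.
rewrite -[leLHS]/(g u).
have <- : g y^T = dot (z - y) (z - y) by rewrite /g trmxK.
(* Points of [X] outside [K] have value above [r], which already bounds [g u]. *)
have [gy|/ltW gy] := leP (g y^T) r; last exact: le_trans gy.
by apply: umin; apply/mem_set; split; rewrite /= ?trmxK.
Qed.

(** Existence rules out the default value of [xget], and uniqueness identifies its choice with
    [x]. *)
Lemma eq_ProjP (z x : 'cV[R]_n) :
  x = Proj X z <-> X x /\ forall y, X y -> 0 <= dot (x - z) (y - x).
Proof.
rewrite -argmin_norm2P /Proj; split=> [->|xmin].
  exact: xgetPex (argmin_norm2_exists z).
exact: argmin_norm2_uniq xmin (xgetI _ xmin).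
Qed.

Lemma Proj_step_fixP (alpha : R) (v x : 'cV[R]_n) : 0 < alpha ->
  x = Proj X (x - alpha *: v) <-> X x /\ forall y, X y -> 0 <= dot v (y - x).
Proof.
move=> alpha0; rewrite eq_ProjP subKr.
by split=> -[Xx h]; split=> // y /h; rewrite dotZl pmulr_rge0.
Qed.

Lemma scaled_step_fixP (f : 'cV[R]_n -> R) (alpha : R) (g x : 'cV[R]_n) :
  0 < alpha -> (forall i, 0 < g i 0) ->
  x = Proj X (x - alpha *: (scaling X f alpha g x *m grad f x)) <->
  x = Proj X (x - alpha *: grad f x).
Proof.
move=> alpha0 g0; rewrite !Proj_step_fixP// /scaling.
case: asboolP => [Xz|_]; last by rewrite mul1mx.
set v := grad f x in Xz *.
(* Here [z - x] is [- alpha] times [diagc g *m v]. The scaled step takes [w = diagc g *m v], the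
   unscaled one [w = v]. *)
have step (w : 'cV[R]_n) : (forall y, X y -> 0 <= dot w (y - x)) ->
    dot w (diagc g *m v) <= 0.
  by move=> /(_ _ Xz); rewrite addrC addKr dotNr dotZr oppr_ge0 pmulr_rle0.
split=> -[Xx h]; split=> // y Xy; have := step _ h.
  by move=> /dotvv_le0/(diagc_mul_eq0 _ _ g0) ->; rewrite dot0l.
by move=> /(dot_diagc_eq0 _ _ g0) ->; rewrite mulmx0 dot0l.
Qed.

End VariationalInequality.

(** * Expansion and gradient of the quadratic objective *)

Section QuadraticObjective.
Context {R : realType} {n : nat}.
Variables (A : 'M[R]_n) (b : 'cV[R]_n) (c : R) (f : 'cV[R]_n -> R).
Hypothesis A_sym : A^T = A.
Hypothesis fE : forall x : 'cV[R]_n,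
  f x = 2^-1 * (x^T *m A *m x) 0 0 + (b^T *m x) 0 0 + c.

(** Symmetry of [A] merges the two cross terms. The expansion yields both the gradient and the
    optimality condition. *)
Lemma quadratic_expand (x : 'cV[R]_n) t (d : 'cV[R]_n) :
  f (x + t *: d) =
  f x + t * dot (A *m x + b) d + t ^+ 2 * (2^-1 * (d^T *m A *m d) 0 0).
Proof.
have fdot y : f y = 2^-1 * dot y (A *m y) + dot b y + c by rewrite fE -mulmxA.
rewrite -mulmxA -[(d^T *m _) 0 0]/(dot d (A *m d)) !fdot.
have sym : dot x (A *m d) = dot d (A *m x).
  by rewrite dotC /dot trmx_mul A_sym mulmxA.
rewrite mulmxDr -scalemxAr !(dotDl, dotDr, dotZl, dotZr) sym (dotC (A *m x)).
by field.
Qed.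

(** By the expansion, the difference quotient along a basis vector is [l + h * q] for [h != 0],
    which tends to [l]. *)
Lemma grad_quadratic (x : 'cV[R]_n) : grad f x = A *m x + b.
Proof.
apply/matrixP => i j; rewrite ord1 mxE.
set d := delta_mx i 0; set q := 2^-1 * (d^T *m A *m d) 0 0.
have <- : dot (A *m x + b) d = (A *m x + b) i 0 by rewrite dotC dot_delta.
set l := dot _ d.
apply/cvg_lim => //.
have hq_cvg : h * q @[h --> (0 : R)^'] --> 0 * q.
  by apply: cvgMl; exact: nbhs_dnbhs.
have : l + h * q @[h --> (0 : R)^'] --> l + 0 * q.
  by apply: cvgD => //; exact: cvg_cst.
rewrite mul0r addr0; apply: cvg_trans; apply: near_eq_cvg.
near=> h.
have h0 : h != 0 by near: h; exact: nbhs_dnbhs_neq.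
rewrite /= (addrC _ x) quadratic_expand -/l -/q /GRing.scale/=.
by field.
Unshelve. all: by end_near.
Qed.

End QuadraticObjective.

Theorem proposition1 (R : realType) (n : nat) (X : set 'cV[R]_n)
    (X_neq0 : X !=set0) (X_closed : closed X)
    (X_convex : convex_set (X : set (convex_lmodType 'cV[R]_n)))
    (A : 'M[R]_n) (b : 'cV[R]_n) (c : R)
    (A_sym : A^T = A) (A_psd : possemidef A)
    (f : 'cV[R]_n -> R)
    (fE : forall x : 'cV[R]_n,
       f x = 2^-1 * (x^T *m A *m x) 0 0 + (b^T *m x) 0 0 + c)
    (alpha : R) (alpha_gt0 : 0 < alpha)
    (gamma : nat -> 'cV[R]_n) (gamma_gt0 : forall k i, 0 < gamma k i 0) :
  forall k : nat,
    [set x | x = Proj X (x - alpha *: (scaling X f alpha (gamma k) x *m grad f x))]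
      = [set x | x = Proj X (x - alpha *: grad f x)]
    /\
    [set x | x = Proj X (x - alpha *: (scaling X f alpha (gamma k) x *m grad f x))]
      = argmin X f.
Proof.
have expand := quadratic_expand A b c f A_sym fE.
(* Positive semidefiniteness supplies the convexity needed in [argmin_quadraticP]. *)
have Q_ge0 (d : 'cV[R]_n) : 0 <= 2^-1 * (d^T *m A *m d) 0 0.
  by rewrite mulr_ge0 ?invr_ge0.
have ProjP := Proj_step_fixP X_convex X_neq0 X_closed.
move=> k.
have scaledP x := scaled_step_fixP X_convex X_neq0 X_closed f alpha (gamma k) x
  alpha_gt0 (gamma_gt0 k).
(* The first equality is [scaledP]; the second goes through the variational inequality for
   [grad f x]. *)
split; apply/seteqP; split=> x /=; rewrite scaledP// ProjP//.
  rewrite (grad_quadratic _ _ _ _ A_sym fE).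
  by move=> /(argmin_quadraticP X_convex _ _ _ _ (expand x) Q_ge0).
rewrite (grad_quadratic _ _ _ _ A_sym fE).
by move=> /(argmin_quadraticP X_convex _ _ _ _ (expand x) Q_ge0).
Qed.
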